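(* Let $G$ and $H$ be finite simple connected graphs, each with at least two vertices. Let $(x_1,y_1),(x_2,y_2)\in V(G\boxtimes H)$, where $x_1\ne x_2$, $y_1\neq y_2$, $x_1x_2\notin E(G)$ and $y_1y_2\notin E(H)$. If $(x,y)\in V(G\boxtimes H)\setminus\left(N((x_1,y_1))\cup N((x_2,y_2))\right)$, then $(x,y)\in T_{G\boxtimes H}((x_1,y_1),(x_2,y_2))$.
   Context: $N(v)$ denotes the open neighborhood of a vertex $v$ (here in $G\boxtimes H$). The strong product $G\boxtimes H$ has vertex set $V(G)\times V(H)$; $(g_1,h_1)$ and $(g_2,h_2)$ are adjacent iff ($g_1g_2\in E(G)$ and $h_1=h_2$) or ($g_1=g_2$ and $h_1h_2\in E(H)$) or ($g_1g_2\in E(G)$ and $h_1h_2\in E(H)$). For two different non-adjacent vertices $u,v$ of a graph $F$, a tolled walk between $u$ and $v$ is a sequence of vertices $u,w_1,\dots,w_k,v$ with $k\ge 1$ such that consecutive vertices of $w_1,\dots,w_k$ are adjacent, $uw_i\in E(F)$ if and only if $i=1$, and $vw_i\in E(F)$ if and only if $i=k$. If $uv\in E(F)$, the only tolled walk between $u$ and $v$ is $u,v$; the only tolled walk from $v$ to itself is the single vertex $v$. The toll interval $T_F(u,v)$ is the set of all vertices of $F$ lying on some tolled walk between $u$ and $v$. *)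

(* Defs.v *)
From mathcomp Require Import all_boot.

Set Implicit Arguments.
Unset Strict Implicit.
Unset Printing Implicit Defensive.

(* A finite graph is a finType of vertices together with its adjacency
   relation. *)
Definition simple_graph (V : finType) (e : rel V) : Prop :=
  symmetric e /\ irreflexive e.

Definition connected_graph (V : finType) (e : rel V) : Prop :=
  forall x y : V, connect e x y.

Definition open_neighborhood (V : finType) (e : rel V) (v : V) : {set V} :=
  [set w | e v w].

Definition strong_product (V W : finType) (g : rel V) (h : rel W) :
    rel (V * W) :=
  fun a b => [|| g a.1 b.1 && (a.2 == b.2),
                 (a.1 == b.1) && h a.2 b.2 |
                 g a.1 b.1 && h a.2 b.2].

(* The argument p lists all the vertices of the walk, endpoints included.  In
   the nonadjacent case w is w_1, ..., w_k, so that w_i is nth u w i.-1; the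
   adjacencies u w_1 and w_k v come from the last two conditions. *)
Definition tolled_walk (V : finType) (e : rel V) (u v : V) (p : seq V) : Prop :=
  if u == v then p = [:: u]
  else if e u v then p = [:: u; v]
  else exists w : seq V,
    [/\ p = u :: rcons w v,
        0 < size w,
        sorted e w,
        forall i, 1 <= i <= size w -> e u (nth u w i.-1) = (i == 1)
      & forall i, 1 <= i <= size w -> e v (nth u w i.-1) = (i == size w)].

Definition toll_interval (V : finType) (e : rel V) (u v : V) : V -> Prop :=
  fun z => exists2 p : seq V, tolled_walk e u v p & z \in p.

(* Main.v *)
Require Import Defs.
From mathcomp Require Import all_boot.

Set Implicit Arguments.
Unset Strict Implicit.
Unset Printing Implicit Defensive.

(** Write K for the strong product, u and v for the two given vertices, and
    call b far from a when b lies outside the closed neighborhood of a.  A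
    vertex z far from u and from v lies on a tolled walk from u to v as soon as
    some walk from z to v avoids N(u) and some walk from z to u avoids N(v): cut
    each of them at its first visit to the neighborhood of its target, and glue
    the two at z.  In K, z far from u means that one of its coordinates is far
    from the corresponding coordinate of u; so one moves first inside the fiber
    where that coordinate is constant, until the other one agrees with that of
    v, and then inside a fiber of v.  If z is u or v, any tolled walk will do,
    and (x1, y2) provides one. *)

Definition far (T : eqType) (e : rel T) (a b : T) : bool :=
  (a != b) && ~~ e a b.

(** Only the target of each step is tested, so the start of a walk is unconstrained; as a relation,
    it can be fed to [path] and [connect]. *)
Definition avoid (T : Type) (e : rel T) (u : T) : rel T :=
  fun a b => e a b && ~~ e u b.

Lemma far_sym (T : eqType) (e : rel T) : symmetric e -> symmetric (far e).
Proof. by move=> e_sym a b; rewrite /far eq_sym e_sym. Qed.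

Lemma path_avoid (T : Type) (e : rel T) (u z : T) (p : seq T) :
  path (avoid e u) z p = path e z p && all (fun w => ~~ e u w) p.
Proof.
elim: p z => //= a p IHp z; rewrite IHp /avoid.
by case: (e z a); case: (e u a); rewrite ?andbF.
Qed.

Lemma homo_connect_fun (T T' : finType) (e : rel T) (e' : rel T') (f : T -> T') :
  {homo f : a b / e a b >-> e' a b} ->
  {homo f : a b / connect e a b >-> connect e' a b}.
Proof.
move=> fP a _ /connectP[p e_p ->].
by apply/connectP; exists (map f p); [apply: homo_path e_p | rewrite last_map].
Qed.

Section TolledWalks.

Variables (T : finType) (e : rel T).
Hypothesis e_sym : symmetric e.

(** A walk can enter [v] only from a neighbor of [v], so it meets N(v) before or upon arriving.
    Keeping [r] apart from [e] lets the prefix inherit the avoidance of another neighborhood. *)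
Lemma path_first_neighbor (r : rel T) (z v : T) (p : seq T) :
    subrel r e -> path r z p -> last z p = v -> far e v z ->
  exists s b, [/\ path r z (rcons s b), e v b & all (fun w => ~~ e v w) s].
Proof.
move=> sub_re; elim: p z => [|a p IHp] z /=.
  by move=> _ ->; rewrite /far eqxx.
case/andP=> r_za r_p last_p /andP[v_z e_vz].
case e_va: (e v a); first by exists [::], a; rewrite /= r_za.
have far_a: far e v a.
  rewrite /far e_va andbT; apply: contraNneq e_vz => ->.
  by rewrite e_sym sub_re.
have [s [b [r_s e_vb e_s]]] := IHp a r_p last_p far_a.
by exists (a :: s), b; rewrite /= r_za r_s e_va.
Qed.

Lemma connect_avoid_first (u v z : T) :
    connect (avoid e u) z v -> far e v z ->
  exists s b, [/\ path e z (rcons s b), all (fun w => ~~ e u w) (rcons s b),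
                  e v b & all (fun w => ~~ e v w) s].
Proof.
case/connectP=> p e_p last_p far_z.
have sub_e: subrel (avoid e u) e by move=> a b /andP[].
have [s [b [r_s e_vb e_s]]] := path_first_neighbor sub_e e_p (esym last_p) far_z.
by exists s, b; move: r_s; rewrite path_avoid => /andP[].
Qed.

Lemma nth_only_first (P : pred T) (x0 a : T) (s : seq T) :
    P a -> all (fun w => ~~ P w) s ->
  forall i, 1 <= i <= size (a :: s) -> P (nth x0 (a :: s) i.-1) = (i == 1).
Proof.
move=> Pa /allP notP [//|[//|i]] /= lt_i.
by apply/negbTE/notP/mem_nth.
Qed.

Lemma nth_only_last (P : pred T) (x0 b : T) (s : seq T) :
    P b -> all (fun w => ~~ P w) s ->
  forall i, 1 <= i <= size (rcons s b) ->
    P (nth x0 (rcons s b) i.-1) = (i == size (rcons s b)).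
Proof.
move=> Pb /allP notP [//|i]; rewrite size_rcons /= eqSS ltnS => le_i.
rewrite nth_rcons; case: ltngtP le_i => // lt_i _.
by apply/negbTE/notP/mem_nth.
Qed.

(** The membership of [u] and [v] is recorded for the case where the given vertex is an endpoint. *)
Lemma tolled_walk_through (u v z : T) :
    far e u v -> far e u z -> far e v z ->
    connect (avoid e u) z v -> connect (avoid e v) z u ->
  exists p, [/\ tolled_walk e u v p, u \in p, v \in p & z \in p].
Proof.
move=> /andP[u_v e_uv] far_uz far_vz z_to_v z_to_u.
have [s [b [e_s s_u e_vb s_v]]] := connect_avoid_first z_to_v far_vz.
have [t [a [e_t t_v e_ua t_u]]] := connect_avoid_first z_to_u far_uz.
have [/andP[_ e_uz] /andP[_ e_vz]] := (far_uz, far_vz).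
(* Only [a] lies in N(u) and only [b] in N(v); [wE1] and [wE2] expose them as the two ends of
   [w]. *)
pose w := rev (rcons t a) ++ z :: rcons s b.
have wE1: w = a :: (rev t ++ z :: rcons s b) by rewrite /w rev_rcons.
have wE2: w = rcons (rev (rcons t a) ++ z :: s) b by rewrite rcons_cat.
exists (u :: rcons w v); split.
- rewrite /tolled_walk (negbTE u_v) (negbTE e_uv); exists w; split=> //.
  + by rewrite wE1.
  (* By symmetry the half from [z] to [a] can be read backwards; [cat_rcons] then makes [z] the last
     vertex of that half, where the other one starts. *)
  + have: sorted e (rev (z :: rcons t a)).
      by rewrite rev_sorted /=; under eq_path do rewrite e_sym.
    by rewrite wE1 -cat_rcons rev_cons rev_rcons /= cat_path last_rcons e_s andbT.
  + rewrite wE1; apply: nth_only_first => //.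
    by rewrite all_cat all_rev t_u /= e_uz.
  + rewrite wE2; apply: nth_only_last => //.
    by rewrite all_cat all_rev t_v /= e_vz.
- exact: mem_head.
- by rewrite inE mem_rcons mem_head orbT.
- by rewrite inE mem_rcons inE mem_cat mem_head !orbT.
Qed.

End TolledWalks.

Section StrongProduct.

Variables (V W : finType) (g : rel V) (h : rel W).

Lemma strong_product_sym :
  symmetric g -> symmetric h -> symmetric (strong_product g h).
Proof.
move=> g_sym h_sym a b.
by rewrite /strong_product g_sym h_sym (eq_sym a.1) (eq_sym a.2).
Qed.

(** A closed neighborhood in the strong product is the product of the closed neighborhoods of the
    coordinates. *)
Lemma far_strong_product (a b : V * W) :
  far (strong_product g h) a b = far g a.1 b.1 || far h a.2 b.2.
Proof.
case: a b => [x y] [x' y']; rewrite /far /strong_product xpair_eqE /=.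
by case: (x == x'); case: (y == y'); case: (g x x'); case: (h y y').
Qed.

Hypotheses (g_conn : connected_graph g) (h_conn : connected_graph h).

(** The whole fiber over [x] is far from [u], so every walk of [h] lifts to it. *)
Lemma connect_avoid_column (u : V * W) (x : V) (y y' : W) :
  far g u.1 x -> connect (avoid (strong_product g h) u) (x, y) (x, y').
Proof.
move=> far_x; apply: (@homo_connect_fun _ _ h _ (pair x)) (h_conn y y').
move=> b c h_bc; rewrite /avoid {1}/strong_product /= eqxx h_bc orbT /=.
have: far (strong_product g h) u (x, c) by rewrite far_strong_product far_x.
by case/andP.
Qed.

Lemma connect_avoid_row (u : V * W) (x x' : V) (y : W) :
  far h u.2 y -> connect (avoid (strong_product g h) u) (x, y) (x', y).
Proof.
move=> far_y; apply: (@homo_connect_fun _ _ g _ (pair^~ y)) (g_conn x x').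
move=> b c g_bc; rewrite /avoid {1}/strong_product /= eqxx g_bc /=.
have: far (strong_product g h) u (c, y) by rewrite far_strong_product far_y orbT.
by case/andP.
Qed.

Lemma connect_avoid_strong_product (u v z : V * W) :
    far g u.1 v.1 -> far h u.2 v.2 -> far (strong_product g h) u z ->
  connect (avoid (strong_product g h) u) z v.
Proof.
case: v z => [x' y'] [x y] /= far_x' far_y'.
(* Both fibers through [v] are far from [u]; the coordinate of [z] that is far decides which move
   comes first. *)
rewrite far_strong_product => /orP[far_x | far_y].
- exact: connect_trans (connect_avoid_column y y' far_x)
                       (connect_avoid_row x x' far_y').
- exact: connect_trans (connect_avoid_row x x' far_y)
                       (connect_avoid_column y y' far_x').
Qed.

End StrongProduct.

Theorem corollary3p7 (V W : finType) (g : rel V) (h : rel W)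
    (g_simple : simple_graph g) (h_simple : simple_graph h)
    (g_conn : connected_graph g) (h_conn : connected_graph h)
    (V_ge2 : 2 <= #|V|) (W_ge2 : 2 <= #|W|)
    (x1 x2 : V) (y1 y2 : W)
    (x1_neq_x2 : x1 <> x2) (y1_neq_y2 : y1 <> y2)
    (x1x2_nonadj : ~~ g x1 x2) (y1y2_nonadj : ~~ h y1 y2)
    (x : V) (y : W)
    (xy_notin : (x, y) \notin
       open_neighborhood (strong_product g h) (x1, y1)
       :|: open_neighborhood (strong_product g h) (x2, y2)) :
  toll_interval (strong_product g h) (x1, y1) (x2, y2) (x, y).
Proof.
have [[g_sym _] [h_sym _]] := (g_simple, h_simple).
have far_x: far g x1 x2 by rewrite /far x1x2_nonadj andbT; apply/eqP.
have far_y: far h y1 y2 by rewrite /far y1y2_nonadj andbT; apply/eqP.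
set K := strong_product g h; set u := (x1, y1); set v := (x2, y2).
have walk z: far K u z -> far K v z ->
    exists p, [/\ tolled_walk K u v p, u \in p, v \in p & z \in p].
  move=> far_uz far_vz; apply: tolled_walk_through => //.
  - exact: strong_product_sym.
  - by rewrite far_strong_product far_x.
  - exact: connect_avoid_strong_product.
  - by apply: connect_avoid_strong_product => //=; rewrite far_sym.
(* The corner is far from [u] by its second coordinate and from [v] by its first. *)
have [p [p_walk u_p v_p _]]: exists p,
    [/\ tolled_walk K u v p, u \in p, v \in p & (x1, y2) \in p].
  apply: walk; rewrite far_strong_product /= ?far_y ?orbT //.
  by rewrite (@far_sym _ g) ?far_x.
move: xy_notin; rewrite !inE negb_or => /andP[e_u e_v].
(* Open neighborhoods do not exclude [u] and [v] themselves, which are not far from themselves. *)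
case: (eqVneq u (x, y)) => [<- | u_z]; first by exists p.
case: (eqVneq v (x, y)) => [<- | v_z]; first by exists p.
have far_uz: far K u (x, y) by apply/andP.
have far_vz: far K v (x, y) by apply/andP.
by have [q [q_walk _ _ z_q]] := walk _ far_uz far_vz; exists q.
Qed.
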